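(* Let $P=\{x_1,\dots,x_n\}$ be a nonempty finite partially ordered set, labeled so that $i<j$ whenever $x_i<x_j$ in $P$, let $\hat P=P\cup\{\hat 0,\hat 1\}$, and write $x_0=\hat 0$. Let $K$ be a field and $R$ the join-meet ring arising from $P$. Let $T=\{e_0,\dots,e_n\}\subseteq E(\hat P)$ be a spanning tree of the Hasse diagram of $\hat P$ such that for each $0\le i\le n$ the edge $e_i$ has the form $e_i=(x_i,x_{i'})$ with lower endpoint $x_i$ and upper endpoint $x_{i'}\in\hat P$. Write $E(\hat P)=\{e_0,\dots,e_n,e_{n+1},\dots,e_r\}$ and $P_i=P_{e_i}$ for $0\le i\le r$. For $n+1\le j\le r$, write $e_j=(x,y)$ (with $x<y$), let $C_j$ be the unique cycle of the graph with edges $e_0,\dots,e_n,e_j$, and orient $C_j$ so that $e_j$ is traversed $x\to y$. For $0\le i\le n$ and $n+1\le j\le r$ let $$c_j^{(i)}=\begin{cases}1&\text{if } e_i\text{ appears in }C_j\text{ with orientation }x_i\to x_{i'},\\-1&\text{if } e_i\text{ appears in }C_j\text{ with orientation }x_{i'}\to x_i,\\0&\text{if } e_i\text{ does not appear in }C_j.\end{cases}$$ Then in the divisor class group $\mathrm{Cl}(R)$ one has, for each $0\le i\le n$, $$[P_i]=\sum_{j=n+1}^{r}c_j^{(i)}[P_j].$$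
   Context: In $\hat P$ the order of $P$ is extended by $\hat 0<x_i<\hat 1$ for all $i$. $E(\hat P)$ is the set of edges of the Hasse diagram of $\hat P$: pairs $(x,y)\in\hat P\times\hat P$ with $x<y$ and no $z\in\hat P$ with $x<z<y$. For cycles and spanning trees, the Hasse diagram is regarded as an undirected graph on the vertex set $\hat P$. To each $e\in E(\hat P)$ associate the linear form $f_e$ in the coordinates $x_0,x_1,\dots,x_n$ of $\mathbb{R}^{n+1}$: $f_e=x_i$ if $e=(x_i,\hat 1)$; $f_e=x_i-x_j$ if $e=(x_i,x_j)\in P\times P$; $f_e=x_0-x_j$ if $e=(\hat 0,x_j)$. Let $C\subset\mathbb{R}^{n+1}$ be the cone defined by $f_e\ge 0$ for all $e\in E(\hat P)$; its supporting hyperplanes are the $H_e=\{f_e=0\}$. The join-meet ring arising from $P$ is the affine semigroup ring $R=K[C\cap\mathbb{Z}^{n+1}]$; it is a normal Cohen--Macaulay domain. For $e\in E(\hat P)$, $P_e\subset R$ is the height-one monomial prime ideal spanned over $K$ by all monomials with exponent vector in $(C\setminus H_e)\cap\mathbb{Z}^{n+1}$, and $[P_e]$ is its class in $\mathrm{Cl}(R)$ (written additively). For a spanning tree $T$ as in the claim, the classes $[P_{n+1}],\dots,[P_r]$ form a basis of the free abelian group $\mathrm{Cl}(R)$. *)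

(* Defs.v *)
From HB Require Import structures.
From mathcomp Require Import all_boot all_order all_algebra.
From mathcomp Require Import finmap boolp classical_sets.
From mathcomp.multinomials Require Import monalg.

Set Implicit Arguments.
Unset Strict Implicit.
Unset Printing Implicit Defensive.

Import Order.TTheory GRing.Theory Num.Theory.
Local Open Scope ring_scope.

(** * Weil divisors and the divisor class group *)

Section HeightOne.
Variable A : comNzRingType.

Definition is_prime_ideal (p : {pred A}) : Prop :=
  idealr_closed p /\ prime_idealr_closed p.

Definition strictly_contained (q p : {pred A}) : Prop :=
  {subset q <= p} /\ ~ {subset p <= q}.

(* There is a chain of primes q < p, but no chain of primes q0 < q1 < p. *)
Definition is_height_one_prime (p : {pred A}) : Prop :=
  [/\ is_prime_ideal p,
      exists q, is_prime_ideal q /\ strictly_contained q p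
    & ~ exists q0 q1 : {pred A}, [/\ is_prime_ideal q0, is_prime_ideal q1,
          strictly_contained q0 q1 & strictly_contained q1 p]].

Record height_one_prime := HeightOnePrime {
  hop_pred :> A -> bool;
  hop_height_one : is_height_one_prime hop_pred }.

HB.instance Definition _ := gen_eqMixin height_one_prime.
HB.instance Definition _ := gen_choiceMixin height_one_prime.

Fixpoint ideal_pow (p : {pred A}) (k : nat) (f : A) : Prop :=
  if k is k'.+1 then
    exists2 s : seq (A * A),
      forall uv, uv \in s -> uv.1 \in p /\ ideal_pow p k' uv.2
    & f = \sum_(uv <- s) uv.1 * uv.2
  else True.

(* The contraction to A of the k-th power of the maximal ideal of the
   localization A_p (for A a domain and p prime). *)
Definition symbolic_pow (p : {pred A}) (k : nat) (f : A) : Prop :=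
  exists2 s, s \notin p & ideal_pow p k (s * f).

(* v_p(f) = k, where v_p is the valuation of the discrete valuation ring A_p
   (for A a normal Noetherian domain, p of height one and f nonzero). *)
Definition has_valuation (p : {pred A}) (f : A) (k : nat) : Prop :=
  symbolic_pow p k f /\ ~ symbolic_pow p k.+1 f.

(* The free abelian group on the height-one primes: <<p>> is the prime divisor
   p, and D@_p is the coefficient of p in D. *)
Notation divisor := {malg int[height_one_prime]}.

Definition is_divisor_of (f : A) (D : divisor) : Prop :=
  forall p : height_one_prime, exists2 k : nat,
    has_valuation p f k & D@_p = k%:Z.

(* The subgroup generated by the divisors of the nonzero elements of A; for A a
   domain with fraction field F this is {div(f/g) | f/g in F^*}. *)
Definition principal_divisor : divisor -> bool := fun D =>
  `[< forall G : {pred divisor}, zmod_closed G ->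
        (forall f Df, f != 0 -> is_divisor_of f Df -> Df \in G) ->
        D \in G >].

Fact principal_divisor_zmod_closed : zmod_closed principal_divisor.
Proof.
split=> [|D1 D2 /asboolP D1P /asboolP D2P].
  by apply/asboolP => G [G0 _].
apply/asboolP => G cG HG; case: (cG) => _; apply; [exact: D1P | exact: D2P].
Qed.

HB.instance Definition _ :=
  GRing.isZmodClosed.Build divisor principal_divisor
    principal_divisor_zmod_closed.

Definition class_group :=
  Quotient.quot (GRing.ZmodClosed.clone divisor principal_divisor _).
HB.instance Definition _ := GRing.Zmodule.on class_group.

Definition divisor_class (p : height_one_prime) : class_group :=
  (\pi_class_group (<< p >> : divisor))%qT.

End HeightOne.

(** * The bounded extension of a poset and its Hasse diagram *)

Inductive hat (T : Type) := HBot | HElt of T | HTop.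
Arguments HBot {T}.
Arguments HElt {T} _.
Arguments HTop {T}.

Section HatFin.
Variable T : Type.
Definition hat_enc (v : hat T) : option (option T) :=
  match v with HBot => None | HElt p => Some (Some p) | HTop => Some None end.
Definition hat_dec (v : option (option T)) : hat T :=
  match v with None => HBot | Some (Some p) => HElt p | Some None => HTop end.
Fact hat_encK : cancel hat_enc hat_dec. Proof. by case. Qed.
End HatFin.

HB.instance Definition _ (T : eqType) := Equality.copy (hat T)
  (can_type (@hat_encK T)).
HB.instance Definition _ (T : choiceType) := Choice.copy (hat T)
  (can_type (@hat_encK T)).
HB.instance Definition _ (T : countType) := Countable.copy (hat T)
  (can_type (@hat_encK T)).
HB.instance Definition _ (T : finType) := Finite.copy (hat T)
  (can_type (@hat_encK T)).

Section HatOrder.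
Context {d : Order.disp_t} {P : finPOrderType d}.

Definition hat_le (u v : hat P) : bool :=
  match u, v with
  | HBot, _ => true
  | _, HTop => true
  | HElt p, HElt q => (p <= q)%O
  | _, _ => false
  end.

Fact hat_le_refl : reflexive hat_le. Proof. by case=> //= p. Qed.
Fact hat_le_anti : antisymmetric hat_le.
Proof. by case=> [|p|] [|q|] //= /le_anti ->. Qed.
Fact hat_le_trans : transitive hat_le.
Proof. by case=> [|p|] [|q|] [|r|] //=; exact: le_trans. Qed.

HB.instance Definition _ := Order.Le_isPOrder.Build d (hat P)
  hat_le_refl hat_le_anti hat_le_trans.
End HatOrder.

Section Hasse.
Context {d : Order.disp_t} (P : finPOrderType d).

Definition is_edge (e : hat P * hat P) : bool :=
  (e.1 < e.2)%O && [forall z, ~~ ((e.1 < z)%O && (z < e.2)%O)].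

Record hasse_edge := HasseEdge {
  edge_pair :> hat P * hat P;
  edge_pairP : is_edge edge_pair }.

HB.instance Definition _ := [isSub for edge_pair].
HB.instance Definition _ := [Finite of hasse_edge by <:].

Definition adjacent (T : {set hasse_edge}) : rel (hat P) := fun u v =>
  [exists e in T, (val e == (u, v)) || (val e == (v, u))].

Definition is_cycle (T : {set hasse_edge}) (c : seq (hat P)) : bool :=
  (2 < size c)%N && ucycleb (adjacent T) c.

Definition spanning_tree (T : {set hasse_edge}) : Prop :=
  (forall u v, connect (adjacent T) u v) /\ (forall c, ~~ is_cycle T c).

Definition traverses (c : seq (hat P)) (u v : hat P) : bool :=
  (u \in c) && (next c u == v).

(* The cycle of T + e traversing e upwards, listed by its vertices; it is unique
   up to rotation when T is a spanning tree and e is not in T. *)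
Definition fundamental_cycle (T : {set hasse_edge}) (e : hasse_edge) :
    seq (hat P) :=
  xget [::] (fun c => is_cycle (e |: T) c /\ traverses c e.1 e.2).

Definition cycle_sign (c : seq (hat P)) (e : hasse_edge) : int :=
  if traverses c e.1 e.2 then 1
  else if traverses c e.2 e.1 then -1
  else 0.

End Hasse.

Section HatFacts.
Context {d : Order.disp_t} (P : finPOrderType d).
Implicit Types u v w : hat P.

Lemma hat_leE u v : (u <= v)%O = hat_le u v. Proof. by []. Qed.
Lemma hat_leT u : (u <= HTop)%O. Proof. by case: u. Qed.

Lemma hat_exists_edge u : u != HTop -> exists e : hasse_edge P, e.1 = u.
Proof.
move=> uT.
have lt_uT : (u < HTop)%O by rewrite lt_neqAle uT hat_leT.
pose m := [arg min_(v < HTop | (u < v)%O) #|[pred w | (w < v)%O]|].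
have [ltum mP] : (u < m)%O /\
    (forall v, (u < v)%O -> #|[pred w | (w < m)%O]| <= #|[pred w | (w < v)%O]|)%N.
  by rewrite /m; case: arg_minnP.
have ed : is_edge (u, m).
  rewrite /is_edge /= ltum; apply/forallP => z; apply/negP => /andP[uz zm].
  have := mP z uz; rewrite leqNgt => /negP; apply; apply: proper_card.
  apply/properP; split; first by apply/fintype.subsetP => w /lt_trans; apply.
  by exists z; rewrite !inE ?ltxx.
by exists (HasseEdge ed).
Qed.

End HatFacts.

(** * The affine semigroup of a labeled poset *)

(* An enumeration x_1, ..., x_n of P, shifted to the indices 0, ..., n-1. *)
Record labeling d (P : finPOrderType d) (n : nat) := Labeling {
  label :> 'I_n -> P;
  label_bij : bijective label;
  label_mono : forall i j, (label i < label j)%O -> (i < j)%N }.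

Section Semigroup.
Context {d : Order.disp_t} {P : finPOrderType d} {n : nat} (x : labeling P n).

(* vertex 0 is the bottom element x_0, and vertex i is x_i for 0 < i <= n. *)
Definition vertex (i : 'I_n.+1) : hat P :=
  if unlift ord0 i is Some j then HElt (x j) else HBot.

(* The coordinate of a attached to a vertex: a_i at x_i, and 0 at the top. *)
Definition coord (a : 'rV[int]_n.+1) (v : hat P) : int :=
  \sum_(i | vertex i == v) a 0 i.

(* f_e: x_i - x_j for e = (x_i, x_j) with 0 <= i, and x_i for e = (x_i, top). *)
Definition edge_form (e : hasse_edge P) (a : 'rV[int]_n.+1) : int :=
  coord a e.1 - coord a e.2.

(* The lattice points of the cone C. *)
Record cone_point := ConePoint {
  exponent :> 'rV[int]_n.+1;
  cone_pointP : [forall e : hasse_edge P, 0 <= edge_form e exponent] }.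

HB.instance Definition _ := [isSub for exponent].
HB.instance Definition _ := [Choice of cone_point by <:].

Lemma coordD a b v : coord (a + b) v = coord a v + coord b v.
Proof. by rewrite -big_split; apply: eq_bigr => i _; rewrite mxE. Qed.

Lemma coord0 v : coord 0 v = 0.
Proof. by rewrite /coord big1 // => i _; rewrite mxE. Qed.

Lemma edge_formD e a b : edge_form e (a + b) = edge_form e a + edge_form e b.
Proof. by rewrite /edge_form !coordD opprD addrACA. Qed.

Lemma edge_form0 e : edge_form e 0 = 0.
Proof. by rewrite /edge_form !coord0 subrr. Qed.

Lemma edge_form_ge0 (a : cone_point) e : 0 <= edge_form e a.
Proof. by move/forallP: (cone_pointP a). Qed.

Lemma vertex_inj : injective vertex.
Proof.
move=> i j; rewrite /vertex.
case: unliftP => [i'|] ->; case: unliftP => [j'|] -> // [].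
by move/(bij_inj (label_bij x)) ->.
Qed.

Lemma coord_vertex a i : coord a (vertex i) = a 0 i.
Proof.
rewrite /coord (eq_bigl (xpred1 i)) ?big_pred1_eq // => j /=.
exact: (inj_eq vertex_inj).
Qed.

Lemma vertex_neq_top i : vertex i != HTop.
Proof. by rewrite /vertex; case: unliftP. Qed.

Lemma coord_top a : coord a HTop = 0.
Proof. by rewrite /coord big1 // => i /eqP/eqP; rewrite (negPf (vertex_neq_top i)). Qed.

Lemma vertex_surj v : v != HTop -> exists i, vertex i = v.
Proof.
case: v => [_|p _|//].
  by exists ord0; rewrite /vertex unlift_none.
case: (label_bij x) => g _ gK; exists (lift ord0 (g p)).
by rewrite /vertex liftK gK.
Qed.

Lemma coord_ge0 (a : cone_point) v : 0 <= coord a v.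
Proof.
have [k] := ubnP #|[pred w | (v < w)%O]|; elim: k v => // k IHk v.
have [->|/(@hat_exists_edge _ P) [e <-]] := eqVneq v HTop.
  by rewrite coord_top.
rewrite ltnS => le_k; have := edge_form_ge0 a e; rewrite /edge_form subr_ge0.
apply: le_trans; apply: IHk; apply: leq_trans le_k; apply: proper_card.
have /andP[lt12 _] := edge_pairP e.
apply/properP; split; first by apply/fintype.subsetP => w; exact: lt_trans lt12.
by exists e.2; rewrite !inE ?ltxx.
Qed.

Definition cone_zero : cone_point.
Proof. by exists 0; apply/forallP => e; rewrite edge_form0. Defined.

Definition cone_add (a b : cone_point) : cone_point.
Proof.
exists (exponent a + exponent b); apply/forallP => e.
by rewrite edge_formD addr_ge0 ?edge_form_ge0.
Defined.

Fact cone_addA : associative cone_add.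
Proof. by move=> a b c; apply: val_inj; rewrite /= addrA. Qed.
Fact cone_addC : commutative cone_add.
Proof. by move=> a b; apply: val_inj; rewrite /= addrC. Qed.
Fact cone_add0 : left_id cone_zero cone_add.
Proof. by move=> a; apply: val_inj; rewrite /= add0r. Qed.
Fact cone_add0r : right_id cone_zero cone_add.
Proof. by move=> a; rewrite cone_addC cone_add0. Qed.
Fact cone_add_eq0 a b : cone_add a b = cone_zero -> a = cone_zero /\ b = cone_zero.
Proof.
move=> /(congr1 val) /= ab0.
suff H (c c' : cone_point) : exponent c + exponent c' = 0 -> c = cone_zero.
  by split; [exact: H ab0 | apply: H; rewrite addrC; exact: ab0].
move=> c0; apply/val_inj/rowP => i /=; apply/eqP.
have := coord_ge0 c (vertex i); have := coord_ge0 c' (vertex i).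
rewrite !coord_vertex => c'i ci; have /rowP/(_ i)/eqP := c0.
by rewrite !mxE paddr_eq0 // => /andP[].
Qed.

HB.instance Definition _ := Choice_isMonomialDef.Build cone_point
  cone_addA cone_add0 cone_add0r cone_add_eq0.
HB.instance Definition _ := MonomialDef_isConomialDef.Build cone_point cone_addC.

Definition cone_monoid : conomType := ConomialDef.clone cone_point _.

Lemma coord_fun (h : hat P -> int) : h HTop = 0 ->
  forall v, coord (\row_i h (vertex i)) v = h v.
Proof.
move=> hT v; have [->|/vertex_surj[i <-]] := eqVneq v HTop.
  by rewrite coord_top.
by rewrite coord_vertex mxE.
Qed.

Lemma edge_lt (e : hasse_edge P) : (e.1 < e.2)%O.
Proof. by case/andP: (edge_pairP e). Qed.

Lemma edge_cover (e : hasse_edge P) z : (e.1 <= z)%O -> (z <= e.2)%O ->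
  z = e.1 \/ z = e.2.
Proof.
rewrite !le_eqVlt => /predU1P[->|lt1]; first by left.
case/predU1P => [->|lt2]; first by right.
by case/andP: (edge_pairP e) => _ /forallP/(_ z); rewrite lt1 lt2.
Qed.

Lemma edge_neq_top (e : hasse_edge P) : (HTop <= e.1)%O = false.
Proof.
apply/negbTE/negP => le; have := lt_le_trans (edge_lt e) (hat_leT _).
by move/(le_lt_trans le); rewrite ltxx.
Qed.

Lemma exists_uniformizer e : exists a : cone_point, edge_form e a = 1.
Proof.
pose h v : int := (v <= e.1)%O%:R.
have hT : h HTop = 0 by rewrite /h edge_neq_top.
have aP : [forall e', 0 <= edge_form e' (\row_i h (vertex i))].
  apply/forallP => e'; rewrite /edge_form !coord_fun // subr_ge0 /h ler_nat.
  case: (boolP (e'.2 <= e.1)%O) => // le2; rewrite (le_trans _ le2) //.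
  exact/ltW/edge_lt.
exists (ConePoint aP); rewrite /= /edge_form !coord_fun // /h lexx.
by rewrite (lt_geF (edge_lt e)) subr0.
Qed.

Lemma exists_facet_interior e : exists2 b : cone_point, edge_form e b = 0 &
  forall e', e' != e -> 0 < edge_form e' b.
Proof.
pose r u v := (u <= v)%O || ((u <= e.2)%O && (e.1 <= v)%O).
pose N v := #|[pred w | r v w]|.
pose h v : int := (N v)%:Z - (N HTop)%:Z.
have hT : h HTop = 0 by rewrite /h subrr.
have rtrans : transitive r.
  move=> v u w /orP[uv|/andP[u2 v1]] /orP[vw|/andP[v2 w1]]; rewrite /r.
  - by rewrite (le_trans uv vw).
  - by rewrite (le_trans uv v2) w1 orbT.
  - by rewrite u2 (le_trans v1 vw) orbT.
  - by rewrite u2 w1 orbT.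
have r21 : r e.2 e.1 by rewrite /r !lexx orbT.
have r12 : r e.1 e.2 by rewrite /r (ltW (edge_lt e)).
have form e' : edge_form e' (\row_i h (vertex i)) = (N e'.1)%:Z - (N e'.2)%:Z.
  by rewrite /edge_form !coord_fun // /h opprB addrA subrK.
have N12 : N e.1 = N e.2.
  by apply: eq_card => w; rewrite !inE; apply/idP/idP; apply: rtrans.
have gt0 e' : e' != e -> (N e'.2 < N e'.1)%N.
  move=> e'e; apply: proper_card; apply/properP; split.
    apply/fintype.subsetP => w; rewrite !inE; apply: rtrans.
    by rewrite /r (ltW (edge_lt e')).
  exists e'.1; rewrite !inE; first by rewrite /r lexx.
  rewrite /r (lt_geF (edge_lt e')) /=; apply/negP.
  case/andP => le2 le1; have lt' := edge_lt e'.
  have := edge_cover (le_trans le1 (ltW lt')) le2.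
  have := edge_cover le1 (le_trans (ltW lt') le2).
  move=> [E1|E1] [E2|E2].
  - by move: lt'; rewrite E1 E2 ltxx.
  - by case/eqP: e'e; apply: val_inj;
    rewrite /= [val e']surjective_pairing E1 E2 -surjective_pairing.
  - by move: lt'; rewrite E1 E2 => /(lt_trans (edge_lt e)); rewrite ltxx.
  - by move: lt'; rewrite E1 E2 ltxx.
have bP : [forall e', 0 <= edge_form e' (\row_i h (vertex i))].
  apply/forallP => e'; rewrite form subr_ge0 lez_nat.
  by have [->|/gt0/ltnW//] := eqVneq e' e; rewrite N12.
exists (ConePoint bP) => [|e' /gt0]; rewrite /= form ?N12 ?subrr //.
by rewrite subr_gt0 ltz_nat.
Qed.

Lemma divide_monomial e (a m : cone_point) : edge_form e a = 1 -> edge_form e m != 0 ->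
  exists w g : cone_point, edge_form e w = 0 /\ mmul w m = mmul a g.
Proof.
move=> ea em; have [b eb bP] := exists_facet_interior e.
pose N := (\sum_e' `|edge_form e' a|)%N.
have formM e' : edge_form e' (exponent b *+ N) = edge_form e' b *+ N.
  by elim: N => [|N IH]; rewrite ?mulr0n ?edge_form0 // !mulrS edge_formD IH.
have formN e' v : edge_form e' (- v) = - edge_form e' v.
  by apply/eqP; rewrite -addr_eq0 -edge_formD addNr edge_form0.
have wP : [forall e', 0 <= edge_form e' (exponent b *+ N)].
  by apply/forallP => e'; rewrite formM mulrn_wge0 ?edge_form_ge0.
have gP : [forall e', 0 <= edge_form e' (exponent b *+ N + exponent m - exponent a)].
  apply/forallP => e'; rewrite !edge_formD formM formN.
  have [->|/bP b_gt0] := eqVneq e' e.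
    rewrite eb mul0rn add0r ea subr_ge0 -gtz0_ge1 lt_neqAle eq_sym em.
    exact: edge_form_ge0.
  rewrite addrAC addr_ge0 ?edge_form_ge0 // subr_ge0.
  apply: (@le_trans _ _ (N%:Z)).
    rewrite -[leLHS]gez0_abs ?edge_form_ge0 // lez_nat /N.
    by rewrite (bigD1 e') //= leq_addr.
  rewrite -mulr_natl -[leLHS]mulr1 natz ler_wpM2l // .
exists (ConePoint wP), (ConePoint gP); split; first by rewrite /= formM eb mul0rn.
by apply: val_inj; rewrite /= [RHS]addrC subrK.
Qed.

End Semigroup.


(** * Monomial primes in monoid algebras *)

Section LexPos.
Variable r : nat.

Definition lex_pos (v : 'rV[int]_r) : bool :=
  [exists i, (0 < v 0 i) && [forall j : 'I_r, (j < i)%N ==> (v 0 j == 0)]].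

Lemma lex_posD u v : lex_pos u -> lex_pos v -> lex_pos (u + v).
Proof.
case/existsP => i /andP[ui /forallP ui0] /existsP[j /andP[vj /forallP vj0]].
have u0 (k : 'I_r) : (k < i)%N -> u 0 k = 0.
  by move=> lt; apply/eqP/(implyP (ui0 k)).
have v0 (k : 'I_r) : (k < j)%N -> v 0 k = 0.
  by move=> lt; apply/eqP/(implyP (vj0 k)).
apply/existsP; have [lt|lt|/val_inj eqij] := ltngtP i j.
- exists i; rewrite mxE v0 // addr0 ui; apply/forallP => k; apply/implyP => ki.
  by rewrite mxE u0 // v0 ?addr0 // (ltn_trans ki).
- exists j; rewrite mxE u0 // add0r vj; apply/forallP => k; apply/implyP => kj.
  by rewrite mxE v0 // u0 ?addr0 // (ltn_trans kj).
- exists i; rewrite mxE addr_gt0 ?eqij // -?eqij //; apply/forallP => k.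
  by apply/implyP => ki; rewrite mxE u0 ?v0 ?addr0 // -eqij.
Qed.

Lemma lex_pos0 : lex_pos 0 = false.
Proof. by apply/negbTE/existsPn => i; rewrite mxE ltxx. Qed.

Lemma lex_pos_total v : v != 0 -> lex_pos v || lex_pos (- v).
Proof.
move=> v0; have /existsP[i0 vi0] : [exists i, v 0 i != 0].
  apply: contraNT v0 => /existsPn H; apply/eqP/rowP => i.
  by rewrite mxE; apply/eqP; move: (H i); rewrite negbK.
pose i := [arg min_(i < i0 | v 0 i != 0) (i : nat)].
have [vi iP] : v 0 i != 0 /\ (forall j : 'I_r, v 0 j != 0 -> (i <= j)%N).
  by rewrite /i; case: arg_minnP.
have vj0 (j : 'I_r) : (j < i)%N -> v 0 j = 0.
  by move=> ji; apply: contraTeq ji => /iP; rewrite -leqNgt.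
apply/orP; have [neg|pos|/eqP] := ltgtP (v 0 i) 0; last by rewrite (negPf vi).
  right; apply/existsP; exists i; rewrite mxE oppr_gt0 neg.
  by apply/forallP => j; apply/implyP => /vj0; rewrite mxE => ->; rewrite oppr0.
left; apply/existsP; exists i; rewrite pos.
by apply/forallP => j; apply/implyP => /vj0 ->.
Qed.

End LexPos.

Section MonoidAlgebra.
Variables (K : fieldType) (M : conomType) (r : nat) (emb : M -> 'rV[int]_r).
Hypothesis embD : forall a b, emb (mmul a b) = emb a + emb b.
Hypothesis emb_inj : injective emb.

Local Notation R := {malg K[M]}.
Local Notation mon a := (<< a >> : {malg K[M]}).
Implicit Types (f g h : R) (a b m : M).

Lemma lex_max (F : pred (M)) f : (exists2 a, f@_a != 0 & F a) ->
  exists m, [/\ f@_m != 0, F m &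
    forall a, f@_a != 0 -> F a -> a != m -> lex_pos (emb m - emb a)].
Proof.
case=> a0 fa0 Fa0.
have: exists m, [/\ m \in enum_fset (msupp f), F m & forall a,
    a \in enum_fset (msupp f) -> F a -> a != m -> lex_pos (emb m - emb a)].
  have: has F (msupp f).
    by apply/hasP; exists a0 => //; rewrite -mcoeff_neq0.
  elim: (enum_fset (msupp f)) => //= b s IHs.
  have [/IHs [m [ms Fm mP]] _|hs] := boolP (has F s); last first.
    rewrite orbF => Fb; exists b; split; rewrite ?mem_head // => a.
    rewrite inE => /predU1P[->|sa] Fa; first by rewrite eqxx.
    by case/hasP: hs; exists a.
  have [Fb|nFb] := boolP (F b); last first.
    exists m; split=> //; first by rewrite inE ms orbT.
    move=> a; rewrite inE => /predU1P[->|sa]; last exact: mP.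
    by move/negPf: nFb ->.
  have [->|bm] := eqVneq b m.
    exists m; split=> //; first by rewrite mem_head.
    by move=> a; rewrite inE => /predU1P[->|]; [rewrite eqxx | exact: mP].
  have [pos|npos] := boolP (lex_pos (emb m - emb b)).
    exists m; split=> //; first by rewrite inE ms orbT.
    by move=> a; rewrite inE => /predU1P[->|]; [ | exact: mP].
  have pos : lex_pos (emb b - emb m).
    have: emb m - emb b != 0.
      by rewrite subr_eq0; apply: contraNneq bm => e; apply/eqP/emb_inj.
    by move/lex_pos_total; rewrite (negPf npos) opprB.
  exists b; split=> //; first by rewrite mem_head.
  move=> a; rewrite inE => /predU1P[->|sa] Fa; first by rewrite eqxx.
  have [->//|am _] := eqVneq a m.
  by rewrite -(subrK (emb m) (emb b)) -addrA lex_posD // mP.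
case=> m [ms Fm mP]; exists m; split=> //; first by rewrite mcoeff_neq0.
by move=> a; rewrite mcoeff_neq0 => /mP.
Qed.

Lemma face_mul (F : pred (M)) f g :
  (forall a b, F (mmul a b) = F a && F b) ->
  (exists2 a, f@_a != 0 & F a) -> (exists2 a, g@_a != 0 & F a) ->
  exists2 a, (f * g : R)@_a != 0 & F a.
Proof.
move=> FM /lex_max[m [fm Fm mP]] /lex_max[m' [gm Fm' mP']].
exists (mmul m m'); last by rewrite FM Fm Fm'.
suff -> : (f * g : R)@_(mmul m m') = f@_m * g@_m' by rewrite mulf_neq0.
have uniqP k1 k2 : f@_k1 != 0 -> g@_k2 != 0 -> mmul k1 k2 = mmul m m' ->
    k1 = m /\ k2 = m'.
  move=> f1 g2 eqk; have := FM k1 k2; rewrite eqk FM Fm Fm' => /esym/andP[F1 F2].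
  have /(congr1 emb) := eqk; rewrite !embD => eqv.
  have dif : emb m - emb k1 = - (emb m' - emb k2).
    by apply/eqP; rewrite opprB subr_eq addrAC eq_sym subr_eq -eqv addrC.
  have [k1m|/(mP _ f1 F1) pos] := eqVneq k1 m.
    split=> //; move: dif; rewrite k1m subrr => /eqP.
    by rewrite eq_sym oppr_eq0 subr_eq0 => /eqP e; apply: emb_inj.
  have [k2m|/(mP' _ g2 F2) pos'] := eqVneq k2 m'.
    by move: pos; rewrite dif k2m subrr oppr0 lex_pos0.
  by have := lex_posD pos pos'; rewrite dif addNr lex_pos0.
rewrite mcoeffMl (big_fsetD1 m) /=; last by rewrite -mcoeff_neq0.
rewrite [X in _ + X = _]big1_fset; last first.
  move=> k1; rewrite in_fsetD1 -mcoeff_neq0 => /andP[k1m f1] _.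
  rewrite big1_fset // => k2; rewrite -mcoeff_neq0 => g2 _.
  case: eqP => [/(uniqP _ _ f1 g2)[e _]|_]; last by rewrite mulr0n.
  by rewrite e eqxx in k1m.
rewrite addr0 (big_fsetD1 m') /=; last by rewrite -mcoeff_neq0.
rewrite eqxx mulr1n [X in _ + X = _]big1_fset ?addr0 // => k2.
rewrite in_fsetD1 -mcoeff_neq0 => /andP[k2m g2] _.
case: eqP => [/(uniqP _ _ fm g2)[_ e]|_]; last by rewrite mulr0n.
by rewrite e eqxx in k2m.
Qed.

Lemma zero_prime : is_prime_ideal (pred1 (0 : R)).
Proof.
split.
  split=> [||a u v]; rewrite ?inE ?oner_eq0 //.
  by move=> /eqP -> /eqP ->; rewrite mulr0 addr0.
move=> u v; rewrite !inE; apply: contraTT; rewrite negb_or => /andP[u0 v0].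
have nz f : f != 0 -> exists2 a, f@_a != 0 & predT a.
  rewrite -msupp_eq0 => /fset0Pn[a]; rewrite -mcoeff_neq0 => fa.
  by exists a.
have [//|a uva _] := @face_mul predT u v _ (nz _ u0) (nz _ v0).
by apply: contraNneq uva => ->; rewrite mcoeff0.
Qed.

Lemma monD_eq a b : mon a * mon b = mon (mmul a b).
Proof. by rewrite malgM_def fgmulUU mulr1. Qed.

Lemma mcoeff_mul_mon w m f : (mon w * f : R)@_(mmul w m) = f@_m.
Proof.
rewrite mcoeffMr; have [fm|] := boolP (m \in msupp f); last first.
  move=> nfm; rewrite [RHS]mcoeff_outdom // big1_fset // => k fk _.
  rewrite msuppU1 big_seq_fset1 mcoeffUU mul1r; case: eqP => [|_] //.
  move/(congr1 emb); rewrite !embD => /addrI/emb_inj e.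
  by rewrite -e fk in nfm.
rewrite (big_fsetD1 m) //= msuppU1 big_seq_fset1 mcoeffUU mul1r eqxx mulr1n.
rewrite big1_fset ?addr0 // => k; rewrite in_fsetD1 => /andP[km _] _.
rewrite big_seq_fset1; case: eqP => [|_] //.
move/(congr1 emb); rewrite !embD => /addrI/emb_inj e.
by rewrite e eqxx in km.
Qed.

Variable phi : M -> int.

(* The K-span of the monomials on which phi does not vanish. *)
Definition face_prime : {pred R} := fun f => all (fun a => phi a != 0) (msupp f).

Hypothesis phi_ge0 : forall a, 0 <= phi a.
Hypothesis phiD : forall a b, phi (mmul a b) = phi a + phi b.

Lemma face_primeP f :
  reflect (forall a, f@_a != 0 -> phi a != 0) (f \in face_prime).
Proof.
apply: (iffP allP) => H a; first by rewrite mcoeff_neq0 => /H.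
by rewrite -mcoeff_neq0 => /H.
Qed.

Lemma face_primePn f : f \notin face_prime ->
  exists2 a, f@_a != 0 & phi a = 0.
Proof.
by case/allPn => a; rewrite -mcoeff_neq0 negbK => fa /eqP ea; exists a.
Qed.

Lemma phi1 : phi mone = 0.
Proof. by apply: (addrI (phi mone)); rewrite -phiD mulm1 addr0. Qed.

Lemma phiD_eq0 a b : (phi (mmul a b) == 0) = (phi a == 0) && (phi b == 0).
Proof. by rewrite phiD paddr_eq0. Qed.

Lemma face_prime_prime : is_prime_ideal (face_prime).
Proof.
split.
  split.
  - by apply/face_primeP => a; rewrite mcoeff0 eqxx.
  - apply/negP => /face_primeP/(_ mone).
    by rewrite mcoeff1 eqxx oner_eq0 phi1 eqxx => /(_ isT).
  - move=> a u v /face_primeP uP /face_primeP vP.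
    apply/face_primeP => b; rewrite mcoeffD.
    have [->|vb _] := eqVneq (v@_b) 0; last exact: vP.
    rewrite addr0 mcoeff_neq0 => /msuppM_le[k1 [k2 [_]]].
    by rewrite -mcoeff_neq0 => /uP k2P ->; rewrite phiD_eq0 negb_and k2P orbT.
move=> u v; apply: contraTT; rewrite negb_or => /andP[up vp].
have nz f : f \notin face_prime ->
    exists2 a, f@_a != 0 & phi a == 0.
  by move/face_primePn => [a fa ea]; exists a; rewrite // ea eqxx.
have [a b|a uva ea] := face_mul _ (nz _ up) (nz _ vp).
  exact: phiD_eq0.
by apply/negP => /face_primeP/(_ a uva); rewrite ea.
Qed.

Variable a : M.
Hypothesis ea : phi a = 1.
Hypothesis divide_a : forall m, phi m != 0 ->
  exists w g : M, phi w = 0 /\ mmul w m = mmul a g.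

Lemma divide_uniformizer f : f \in face_prime ->
  exists (w : M) (g : R),
    phi w = 0 /\ mon w * f = mon a * g.
Proof.
move=> /face_primeP fP; rewrite (monalgE f).
have: forall m, m \in enum_fset (msupp f) -> phi m != 0.
  by move=> m; rewrite -mcoeff_neq0; exact: fP.
elim: (enum_fset (msupp f)) => [_|m s IHs sP].
  by exists mone, 0; rewrite phi1 big_nil !mulr0.
have [|w [g [ew wg]]] := IHs.
  by move=> k ks; apply: sP; rewrite inE ks orbT.
have [w' [g' [ew' wg']]] := divide_a (sP m (mem_head _ _)).
exists (mmul w w'), (mon w * << f@_m *g g' >> + mon w' * g).
split; first by rewrite phiD ew ew' addr0.
have scalM c k k' : mon k * << c *g k' >> = << c *g mmul k k' >>.
  by rewrite malgM_def fgmulUU mul1r.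
have e1 : mon (mmul w w') * << f@_m *g m >> = mon a * (mon w * << f@_m *g g' >>).
  by rewrite !scalM; congr << _ *g _ >>; rewrite -mulmA wg' !mulmA (mulmC w a).
have e2 (s' : R) : mon w * s' = mon a * g -> mon (mmul w w') * s' = mon a * (mon w' * g).
  by move=> es; rewrite -monD_eq mulrAC es -mulrA (mulrC g).
by rewrite big_cons mulrDr mulrDr e1 (e2 _ wg).
Qed.

Lemma face_prime_height_one : is_height_one_prime (face_prime).
Proof.
have mon_in m : (mon m \in face_prime) = (phi m != 0).
  apply/face_primeP/idP => [/(_ m)|em k]; rewrite mcoeffU1.
    by rewrite eqxx oner_eq0; apply.
  by have [<-//|] := eqVneq m k; rewrite eqxx.
split; first exact: face_prime_prime.
  exists (pred1 (0 : R) : {pred R}); split; first exact: zero_prime.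
  split=> [f|/(_ (mon a))].
    rewrite inE => /eqP ->; apply/face_primeP => k.
    by rewrite mcoeff0 eqxx.
  by rewrite mon_in ea inE monalgU_eq0 !oner_eq0 => /(_ isT).
case=> q0 [q1 [[[q00 _ _] _] [[q10 q1n1 q1I] q1M] [sub01 nsub01] [sub1 nsub1]]].
have q1Mr u v : v \in q1 -> u * v \in q1.
  by move=> vq; rewrite -[u * v]addr0 q1I.
have q1w w : phi w = 0 -> mon w \notin q1.
  by move=> ew; apply: contraTN (introT eqP ew) => /sub1; rewrite mon_in.
have [f fq1 f0] : exists2 f : R, f \in q1 & f != 0.
  apply: contrapT => H; apply: nsub01 => f fq1.
  have [->|f0] := eqVneq f 0; first exact: q00.
  by case: H; exists f.
have aq1 : mon a \in q1.
  have [m fm] : exists m, f@_m != 0.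
    by move: f0; rewrite -msupp_eq0 => /fset0Pn[m]; rewrite -mcoeff_neq0; exists m.
  have [k] := ubnP `|phi m|%N.
  elim: k f fq1 f0 m fm => // k IHk f fq1 _ m fm.
  rewrite ltnS => le_k; have [w [g [ew wg]]] := divide_uniformizer (sub1 _ fq1).
  have : mon a * g \in q1 by rewrite -wg q1Mr.
  case/q1M/orP => // gq1; have := mcoeff_mul_mon w m f.
  rewrite wg => eqf; move: fm; rewrite -eqf mcoeff_neq0 => /msuppM_le[k1 [k2 []]].
  rewrite msuppU1 inE => /eqP -> gk2 eqm; rewrite -mcoeff_neq0 in gk2.
  apply: (IHk g gq1 _ k2 gk2).
    by apply: contraNneq gk2 => ->; rewrite mcoeff0.
  have := phiD w m; rewrite eqm phiD ew ea add0r => em.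
  apply: leq_trans le_k; rewrite -em -ltz_nat !gez0_abs ?phi_ge0 //.
    by rewrite ltrDr.
  by rewrite addr_ge0 ?phi_ge0.
apply: nsub1 => h hp; have [w [g [ew wg]]] := divide_uniformizer hp.
have : mon w * h \in q1 by rewrite wg mulrC q1Mr.
by case/q1M/orP => //; rewrite (negPf (q1w _ ew)).
Qed.

End MonoidAlgebra.

(** * The join-meet ring and its monomial primes *)

Notation join_meet_ring K x := {malg K[cone_monoid x]}.

Section MonomialPrime.
Context (K : fieldType) {d : Order.disp_t} {P : finPOrderType d} {n : nat}.
Variables (x : labeling P n) (e : hasse_edge P).

(* The K-span of the monomials with exponent in C \ H_e. *)
Definition monomial_prime : {pred join_meet_ring K x} :=
  face_prime (fun a : cone_monoid x => edge_form x e (exponent a)).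

Lemma monomial_prime_height_one : is_height_one_prime monomial_prime.
Proof.
have [a ea] := exists_uniformizer x e.
apply: (@face_prime_height_one K (cone_monoid x) _ (@exponent _ _ _ x) _ _
  (fun a : cone_monoid x => edge_form x e (exponent a)) _ _ a) => //.
- exact: val_inj.
- by move=> b; apply: edge_form_ge0.
- by move=> b c; apply: edge_formD.
- by move=> m em; apply: divide_monomial.
Qed.

Definition edge_prime : height_one_prime (join_meet_ring K x) :=
  HeightOnePrime monomial_prime_height_one.

End MonomialPrime.

(* Main.v *)
Require Import Defs.
From mathcomp Require Import all_boot all_order all_algebra.
From mathcomp Require Import boolp classical_sets.
From mathcomp.multinomials Require Import monalg.

Set Implicit Arguments.
Unset Strict Implicit.
Unset Printing Implicit Defensive.

Import Order.TTheory GRing.Theory Num.Theory.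
Local Open Scope ring_scope.

(** The relation comes from the divisor of a Laurent monomial chosen by cutting
    the spanning tree at the edge e_i.

    For a lattice point a of the cone, the divisor of the monomial of a is the
    sum of f_e(a) P_e over all Hasse edges e ([is_divisor_of_mon]).  The
    valuation at P_e is f_e(a) because a uniformizing monomial u, one with
    f_e(u) = 1, satisfies w a = u^k g with f_e(w) = 0 and k = f_e(a), so that
    w is a unit in the localization ([has_valuation_mon]).  Every other
    height-one prime has valuation 0, since a height-one prime that contains a
    monomial is one of the P_e ([height_one_of_mon]).  Every integer vector h is
    a difference of two points of the cone, so the sum of f_e(h) [P_e] vanishes
    for all h ([divisor_class_relation]).

    Take for h the indicator function of the vertices from which the upward walk
    in the tree passes through the edge e_i ([tree_cut]).  Along a tree edge h
    drops by 1 if the edge is e_i, and is constant otherwise, so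
    f_(e_k)(h) is 1 for k = i and 0 for every other tree edge e_k.
    For e_j outside the tree, the increments of h along the fundamental cycle
    C_j add up to 0, and only e_j and e_i contribute; hence
    f_(e_j)(h) = - c_j^(i) ([cycle_sign_cut]).  The relation attached to h is
    the claim. *)

(** * Prime ideals and monoid algebras *)

Section PrimeIdeals.
Variables (A : comNzRingType) (p : {pred A}).

Lemma ideal_pow_expr_mul (u g : A) k : u \in p -> ideal_pow p k (u ^+ k * g).
Proof.
move=> up; elim: k g => [//|k IHk g].
exists [:: (u, u ^+ k * g)]; last by rewrite big_seq1 /= exprS mulrA.
by move=> uv; rewrite inE => /eqP -> /=; split=> //; exact: IHk.
Qed.

Hypothesis p_prime : is_prime_ideal p.

Lemma prime_ideal_mulr u v : v \in p -> u * v \in p.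
Proof. by case: p_prime => -[p0 _ pI] _ vp; rewrite -[u * v]addr0 pI. Qed.

Lemma prime_ideal_sum (I : eqType) (s : seq I) (F : I -> A) :
  (forall i, i \in s -> F i \in p) -> \sum_(i <- s) F i \in p.
Proof.
case: p_prime => -[p0 _ pI] _; elim: s => [|i s IHs] Fp; rewrite ?big_nil //.
rewrite big_cons -[F i]mul1r; apply: pI; first exact/Fp/mem_head.
by apply: IHs => j js; apply: Fp; rewrite inE js orbT.
Qed.

Lemma prime_ideal_prod (I : Type) (s : seq I) (F : I -> A) :
  (forall i, F i \notin p) -> \prod_(i <- s) F i \notin p.
Proof.
case: p_prime => -[_ p1 _] pM Fp; elim/big_rec: _ => // i u _ up.
by apply/negP => /pM /orP[]; apply/negP.
Qed.

Lemma prime_ideal_expr u k : u ^+ k \in p -> u \in p.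
Proof.
case: p_prime => -[_ p1 _] pM; elim: k => [|k IHk].
  by rewrite expr0 (negPf p1).
by rewrite exprS => /pM /orP[].
Qed.

Lemma has_valuation0 u : u \notin p -> has_valuation p u 0.
Proof.
case: (p_prime) => -[_ p1 _] pM up; split; first by exists 1.
case=> s sp [t tP eqsu]; have : s * u \in p.
  rewrite eqsu; apply: prime_ideal_sum => -[a b] /tP[/= ap _].
  by rewrite mulrC prime_ideal_mulr.
by case/pM/orP; apply/negP.
Qed.

End PrimeIdeals.

Lemma height_one_prime_inj (A : comNzRingType) (p q : height_one_prime A) :
  hop_pred p =1 hop_pred q -> p = q.
Proof.
case: p q => [p hp] [q hq] /= /funext eqpq; subst q.
by congr HeightOnePrime; exact: Prop_irrelevance.
Qed.

Lemma mon_expr (K : fieldType) (M : conomType) (m : M) k :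
  (<< m >> : {malg K[M]}) ^+ k = << iter k (mmul m) mone >>.
Proof.
elim: k => [|k IHk]; first by rewrite expr0.
by rewrite exprS IHk monD_eq.
Qed.

Lemma prime_ideal_monomials (K : fieldType) (M : conomType)
    (p : {pred {malg K[M]}}) (f : {malg K[M]}) : is_prime_ideal p ->
  (forall m, f@_m != 0 -> << m >> \in p) -> f \in p.
Proof.
move=> p_prime fP; rewrite (monalgE f).
apply: prime_ideal_sum => // m; rewrite -mcoeff_neq0 => /fP mp.
have -> : << f@_m *g m >> = (f@_m)%:MP * << m >> :> {malg K[M]}.
  by rewrite malgM_def fgmulUU mulr1 mul1m.
exact: prime_ideal_mulr.
Qed.

(** * The valuation of a monomial at a facet *)

Section MonomialValuation.
Variables (K : fieldType) (M : conomType) (r : nat) (emb : M -> 'rV[int]_r).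
Hypothesis embD : forall a b, emb (mmul a b) = emb a + emb b.
Hypothesis emb_inj : injective emb.
Variable phi : M -> int.
Hypothesis phi_ge0 : forall a, 0 <= phi a.
Hypothesis phiD : forall a b, phi (mmul a b) = phi a + phi b.

Local Notation R := {malg K[M]}.
Local Notation mon a := (<< a >> : {malg K[M]}).
Local Notation p := (@face_prime K M phi).

(** A product of k elements of the prime has all its exponents at lattice
    distance at least k from the facet, as phi is additive and at least 1 on the
    exponents of each factor.  This bounds valuations from above. *)
Lemma ideal_pow_face_prime k (f : R) : ideal_pow p k f ->
  forall a, f@_a != 0 -> k%:Z <= phi a.
Proof.
elim: k f => [|k IHk] f; first by move=> _ a _; exact: phi_ge0.
case=> s sP -> a; rewrite raddf_sum /= => fa.
have [uv uvs uva] : exists2 uv, uv \in s & (uv.1 * uv.2)@_a != 0.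
  apply/hasP; apply: contraNT fa => /hasPn H.
  by rewrite big_seq big1 // => uv /H; rewrite negbK => /eqP.
have [/face_primeP up /IHk vp] := sP _ uvs.
move: uva; rewrite mcoeff_neq0 => /msuppM_le[k1 [k2 []]].
rewrite -!mcoeff_neq0 => /up k1P /vp k2P ->.
rewrite phiD -addn1 PoszD addrC lerD //.
by rewrite -gtz0_ge1 lt_neqAle eq_sym k1P phi_ge0.
Qed.

Lemma mon_in_face_prime m : (mon m \in p) = (phi m != 0).
Proof.
apply/face_primeP/idP => [/(_ m)|em k]; rewrite mcoeffU1.
  by rewrite eqxx oner_eq0; apply.
by have [<-//|] := eqVneq m k; rewrite eqxx.
Qed.

Variable a : M.
Hypothesis ea : phi a = 1.
Hypothesis divide_a : forall m, phi m != 0 ->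
  exists w g : M, phi w = 0 /\ mmul w m = mmul a g.

(** Each division by the uniformizer a lowers phi by 1, at the price of a factor
    w outside the prime. *)
Lemma divide_uniformizer_pow k m : phi m = k%:Z ->
  exists w g : M, phi w = 0 /\ mon w * mon m = mon a ^+ k * mon g.
Proof.
elim: k m => [|k IHk] m em.
  by exists mone, m; rewrite (phi1 phiD) expr0 !mul1r.
have [|w [g [ew wm]]] := divide_a (m := m); first by rewrite em.
have eg : phi g = k%:Z.
  by have := phiD w m; rewrite wm phiD ew ea em add0r -add1n PoszD => /addrI.
have [w' [g' [ew' wg']]] := IHk g eg.
exists (mmul w' w), g'; split; first by rewrite phiD ew' ew.
have wm' : mon w * mon m = mon a * mon g by rewrite !monD_eq wm.
by rewrite -monD_eq -mulrA wm' mulrCA wg' exprS mulrA.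
Qed.

Lemma has_valuation_mon m : has_valuation p (mon m) `|phi m|%N.
Proof.
have em : phi m = `|phi m|%N%:Z by rewrite gez0_abs.
split.
  have [w [g [ew eqwm]]] := divide_uniformizer_pow em.
  exists (mon w); first by rewrite mon_in_face_prime ew.
  rewrite eqwm; apply: ideal_pow_expr_mul.
  by rewrite mon_in_face_prime ea.
(* A monomial k of s on the facet gives the monomial m k of s m, at distance
   exactly phi m from the facet. *)
case=> s /face_primePn[k sk ek] /ideal_pow_face_prime/(_ (mmul m k)).
rewrite mulrC (mcoeff_mul_mon embD emb_inj) phiD ek addr0 => /(_ sk).
by rewrite [leRHS]em lez_nat ltnn.
Qed.

End MonomialValuation.

(** * The divisors of the monomials of the join-meet ring *)

Section MonomialDivisor.
Context (K : fieldType) {d : Order.disp_t} {P : finPOrderType d} {n : nat}.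
Variable x : labeling P n.

Local Notation R := (join_meet_ring K x).
Local Notation M := (cone_monoid x).
Local Notation mon a := (<< (a : M) >> : {malg K[M]}).
Local Notation divisor := {malg int[height_one_prime R]}.
Local Notation cl e := (divisor_class (edge_prime K x e)).

Lemma mon_in_edge_prime e (a : M) :
  (mon a \in hop_pred (edge_prime K x e)) = (edge_form x e (exponent a) != 0).
Proof. exact: mon_in_face_prime. Qed.

(** A point in the relative interior of the facet of e1 lies off every other
    facet, so its monomial separates the primes. *)
Lemma edge_prime_inj : injective (edge_prime K x).
Proof.
move=> e1 e2 eq12; have [b eb bP] := exists_facet_interior x e1.
apply/eqP; apply: contraT; rewrite eq_sym => /bP /lt0r_neq0.
by rewrite -(mon_in_edge_prime e2 b) -eq12 mon_in_edge_prime eb eqxx.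
Qed.

Lemma edge_formMn e (v : 'rV[int]_n.+1) k :
  edge_form x e (v *+ k) = edge_form x e v *+ k.
Proof.
by elim: k => [|k IH]; rewrite ?mulr0n ?edge_form0 // !mulrS edge_formD IH.
Qed.

Lemma exponent_iter (m : M) k :
  exponent (iter k (mmul m) mone : M) = exponent m *+ k.
Proof.
elim: k => [|k IHk]; first by rewrite mulr0n.
by rewrite mulrS -IHk.
Qed.

(** A large multiple of an interior point dominates any given vector; on the
    lattice, a positive value of an edge form is at least 1, so N depends on h
    only. *)
Lemma interior_absorbs (h : 'rV[int]_n.+1) : exists N, forall b : M,
  (forall e, edge_form x e (exponent b) != 0) ->
  [forall e, 0 <= edge_form x e (exponent b *+ N + h)].
Proof.
pose N := (\sum_e `|edge_form x e h|)%N; exists N => b b_neq0.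
apply/forallP => e; rewrite edge_formD edge_formMn -lerBlDr sub0r.
apply: (@le_trans _ _ N%:Z).
  apply: le_trans (ler_norm _) _; rewrite normrN -abszE lez_nat /N.
  by rewrite (bigD1 e) //= leq_addr.
rewrite -mulr_natl -[leLHS]mulr1 natz ler_wpM2l //.
by rewrite -gtz0_ge1 lt_neqAle eq_sym b_neq0 edge_form_ge0.
Qed.

Lemma interior_pow_divides (a m : M) :
  (forall e, edge_form x e (exponent m) != 0) ->
  exists N (g : M), mon m ^+ N = mon g * mon a.
Proof.
have [N NP] := interior_absorbs (- exponent a) => /NP gP.
exists N, (ConePoint gP); rewrite mon_expr monD_eq; congr (<< _ >>).
by apply: val_inj; rewrite [RHS]subrK -exponent_iter.
Qed.

(** If p contained no P_e, it would avoid a product of elements F e of the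
    P_e.  All exponents of this product are interior to the cone, so a power of
    each of its monomials is a multiple of the monomial of a, and the product
    lies in p, a contradiction.  Hence p contains some P_e, and the two are
    equal since both have height one. *)
Lemma height_one_of_mon (p : height_one_prime R) (a : M) :
  mon a \in hop_pred p -> exists e, p = edge_prime K x e.
Proof.
move=> ap; have [p_prime _ no_chain] := hop_height_one p.
have [e sub] : exists e, {subset hop_pred (edge_prime K x e) <= hop_pred p}.
  apply: contrapT => /forallNP H.
  have /choice[F FP] e : exists f, f \in hop_pred (edge_prime K x e) /\
      f \notin hop_pred p.
    apply: contrapT => /forallNP He; apply: (H e) => f fe.
    by apply: contrapT => /negP fp; apply: (He f).
  have /negP[] : \prod_e F e \notin hop_pred p.
    by apply: prime_ideal_prod => // e; case: (FP e).
  have prodP e : \prod_e F e \in hop_pred (edge_prime K x e).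
    have [e_prime _ _] := hop_height_one (edge_prime K x e).
    rewrite (bigD1 e) //= mulrC; apply: prime_ideal_mulr => //.
    by case: (FP e).
  apply: (prime_ideal_monomials p_prime) => m fm.
  have [|N [g mN]] := @interior_pow_divides a m.
    by move=> e; have /face_primeP/(_ m fm) := prodP e.
  apply: (prime_ideal_expr (k := N) p_prime).
  by rewrite mN prime_ideal_mulr.
exists e; apply: height_one_prime_inj.
have subp : {subset hop_pred p <= hop_pred (edge_prime K x e)}.
  apply: contrapT => nsub; apply: no_chain.
  have [e_prime [q [q_prime qe]] _] := hop_height_one (edge_prime K x e).
  by exists q, (hop_pred (edge_prime K x e)).
by move=> f; apply/idP/idP; [exact: subp | exact: sub].
Qed.

Lemma is_divisor_of_mon (a : M) : is_divisor_of (mon a)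
  (\sum_e << edge_form x e (exponent a) *g edge_prime K x e >> : divisor).
Proof.
move=> p; rewrite raddf_sum /=.
have [ap|nap] := boolP (mon a \in hop_pred p); last first.
  have [p_prime _ _] := hop_height_one p.
  exists 0%N; first exact: (has_valuation0 p_prime nap).
  rewrite big1 // => e _; rewrite mcoeffU.
  have [ep|_] := eqVneq (edge_prime K x e) p; last by rewrite mulr0n.
  by move: nap; rewrite -ep mon_in_edge_prime negbK => /eqP ->.
have [e ->] := height_one_of_mon ap.
exists `|edge_form x e (exponent a)|%N.
  have [u eu] := exists_uniformizer x e.
  apply: (@has_valuation_mon K M _ (@exponent _ _ _ x) _ _
    (fun b : M => edge_form x e (exponent b)) _ _ u) => //.
  - exact: val_inj.
  - by move=> b; apply: edge_form_ge0.
  - by move=> b c; apply: edge_formD.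
  - by move=> m em; apply: divide_monomial.
rewrite (bigD1 e) //= mcoeffUU big1 ?addr0 ?gez0_abs ?edge_form_ge0 // => e' ne.
by rewrite mcoeffU (inj_eq edge_prime_inj) (negPf ne) mulr0n.
Qed.

Lemma divisor_class_mon (a : M) :
  \sum_e cl e *~ edge_form x e (exponent a) = 0.
Proof.
have mcU c k : << c *g k >> = << k >> *~ c :> divisor.
  by rewrite -(raddfMz (mkmalgU k)) intz.
pose D : divisor := \sum_e << edge_form x e (exponent a) *g edge_prime K x e >>.
have -> : \sum_e cl e *~ edge_form x e (exponent a) =
    (\pi_(class_group R) D)%qT.
  rewrite raddf_sum; apply: eq_bigr => e _.
  by rewrite mcU raddfMz.
apply/eqP; rewrite piE /= Quotient.equivE subr0.
apply/asboolP => G _; apply; last exact: is_divisor_of_mon.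
by rewrite monalgU_eq0 oner_eq0.
Qed.

(** Counting the vertices strictly above gives a strictly order-reversing
    function that vanishes at the top. *)
Lemma exists_cone_interior :
  exists b : M, forall e, 0 < edge_form x e (exponent b).
Proof.
pose h (v : hat P) : int := #|[pred w : hat P | (v < w)%O]|%:Z.
have hT : h HTop = 0.
  rewrite /h (eq_card0 (A := [pred w | _])) // => w.
  by rewrite !inE le_gtF ?hat_leT.
have hP e : 0 < edge_form x e (\row_i h (vertex x i)).
  rewrite /edge_form !coord_fun // subr_gt0 ltz_nat; apply: proper_card.
  apply/properP; split.
    by apply/fintype.subsetP => w; apply: lt_trans; exact: edge_lt.
  by exists e.2; rewrite !inE ?ltxx ?edge_lt.
have bP : [forall e, 0 <= edge_form x e (\row_i h (vertex x i))].
  by apply/forallP => e; exact: ltW.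
by exists (ConePoint bP).
Qed.

(** The vector h is the difference of N b + h and N b, both in the cone for an
    interior point b and large N. *)
Lemma divisor_class_relation (h : 'rV[int]_n.+1) :
  \sum_e cl e *~ edge_form x e h = 0.
Proof.
have [b b_gt0] := exists_cone_interior.
have [N NP] := interior_absorbs h.
have bP : [forall e, 0 <= edge_form x e (exponent b *+ N)].
  by apply/forallP => e; rewrite edge_formMn mulrn_wge0 ?edge_form_ge0.
have aP := NP b (fun e => lt0r_neq0 (b_gt0 e)).
have := divisor_class_mon (ConePoint aP); rewrite -[RHS]addr0.
rewrite -[X in _ = _ + X](divisor_class_mon (ConePoint bP)) add0r /=.
under eq_bigr do rewrite edge_formD mulrzDr.
by rewrite big_split /= => /(canRL (addKr _)); rewrite addNr.
Qed.

End MonomialDivisor.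

(** * Fundamental cycles and cuts of a spanning tree *)

Lemma cycle_telescope (T : eqType) (V : zmodType) (c : seq T) (h : T -> V) :
  uniq c -> \sum_(u <- c) (h u - h (next c u)) = 0.
Proof.
move=> Uc; have pc : perm_eq (map (next c) c) c.
  apply: uniq_perm => // [|u].
    by rewrite map_inj_uniq // => u v /(congr1 (prev c)); rewrite !prev_next.
  apply/mapP/idP => [[v vc ->]|uc]; first by rewrite mem_next.
  by exists (prev c u); rewrite ?mem_prev ?next_prev.
by rewrite sumrB -(big_map (next c) xpredT h) (perm_big _ pc) subrr.
Qed.

(** A cycle of length greater than 2 does not run back and forth along an edge:
    this is why an edge has a well-defined orientation in it. *)
Lemma next_next_neq (T : eqType) (c : seq T) u :
  uniq c -> (2 < size c)%N -> u \in c -> next c (next c u) != u.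
Proof.
move=> Uc c2 /rot_to[i s eqs].
have -> : next c = next (u :: s).
  by apply/funext => v; rewrite -eqs next_rot.
have : uniq (u :: s) by rewrite -eqs rot_uniq.
have : (2 < size (u :: s))%N by rewrite -eqs size_rot.
case: s {eqs} => [|v [|w s]] //= _; rewrite !inE eqxx.
case/andP; rewrite !negb_or => /and3P[uv uw _] /andP[/andP[vw _] _].
by rewrite (eq_sym v) (negPf uv) eqxx eq_sym.
Qed.

Section Cycles.
Context {d : Order.disp_t} (P : finPOrderType d).
Implicit Types (T : {set hasse_edge P}) (e : hasse_edge P) (c : seq (hat P)).

Lemma hasse_edge_eqE e e' : (e.1 == e'.1) && (e.2 == e'.2) = (e == e').
Proof. by rewrite -val_eqE /= -pair_eqE. Qed.

Lemma hasse_edge_antiparallel e e' : (e.1 == e'.2) && (e.2 == e'.1) = false.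
Proof.
apply/negP => /andP[/eqP e12 /eqP e21]; have := edge_lt e.
by rewrite e12 e21 lt_gtF ?edge_lt.
Qed.

Lemma adjacentP T u v : adjacent T u v ->
  exists2 e, e \in T & (u = e.1 /\ v = e.2) \/ (u = e.2 /\ v = e.1).
Proof.
case/exists_inP => e eT /orP[] /eqP/= eE; exists e => //.
  by left; rewrite eE.
by right; rewrite eE.
Qed.

(** A simple path in the tree from the upper to the lower end of e is closed up
    by e; it has length at least 2, since e itself is not in the tree. *)
Lemma fundamental_cycleP T e : (forall u v, connect (adjacent T) u v) ->
  e \notin T -> is_cycle (e |: T) (fundamental_cycle T e) /\
    traverses (fundamental_cycle T e) e.1 e.2.
Proof.
move=> conn eT; apply: (@xgetPex _ [::]
  (fun c => is_cycle (e |: T) c /\ traverses c e.1 e.2)).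
have /connectP[p0 p0T lastp0] := conn e.2 e.1.
case/shortenP: p0T lastp0 => p pT Up _.
case/lastP: p pT Up => [|p v] pT Up.
  by move=> e12; have := edge_lt e; rewrite e12 ltxx.
rewrite last_rcons => ev; rewrite -{v}ev in pT Up.
have adj_sub : subrel (adjacent T) (adjacent (e |: T)).
  move=> u v /exists_inP[e' e'T uv]; apply/exists_inP; exists e' => //.
  by rewrite inE e'T orbT.
exists [:: e.1, e.2 & p]; split; last by rewrite /traverses mem_head /= !eqxx.
apply/andP; split.
  case: p pT {Up} => //= /andP[/adjacentP[e' e'T] + _].
  case=> [[/eqP e21 /eqP e12]|[e2 e1]].
    by have := hasse_edge_antiparallel e e'; rewrite e12 e21.
  suff ee' : e = e' by rewrite ee' e'T in eT.
  by apply/eqP; rewrite -hasse_edge_eqE -e1 -e2 !eqxx.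
rewrite /ucycleb cons_uniq -rcons_uniq Up andbT /= (sub_path adj_sub) // andbT.
by apply/exists_inP; exists e; rewrite ?setU11 // -surjective_pairing eqxx.
Qed.

Lemma sum_traverses c u v : uniq c ->
  \sum_(w <- c) ((w == u) && (next c w == v))%:R = (traverses c u v)%:R :> int.
Proof.
move=> Uc; rewrite /traverses; have [uc|nuc] /= := boolP (u \in c).
  rewrite (bigD1_seq u) //= eqxx big1 ?addr0 // => w /negPf -> //.
rewrite big_seq big1 // => w wc; case: eqP => // wu.
by rewrite -wu wc in nuc.
Qed.

(** The increments of h around the cycle add up to 0, and only the passages
    through e and e0 can contribute. *)
Lemma cycle_sign_cut T e e0 c (h : hat P -> int) :
    (forall e', e' \in T -> h e'.1 - h e'.2 = (e' == e0)%:R) ->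
    e0 \in T -> e \notin T -> is_cycle (e |: T) c -> traverses c e.1 e.2 ->
  h e.1 - h e.2 = - cycle_sign c e0.
Proof.
move=> hT e0T eT /andP[c2 /andP[cycc Uc]] trav.
have ne0 : (e == e0) = false by apply: contraNF eT => /eqP ->.
have no_back u v : traverses c u v -> traverses c v u = false.
  case/andP => uc /eqP <-; apply/negP => /andP[_].
  by apply/negP/next_next_neq.
have -> : cycle_sign c e0 =
    (traverses c e0.1 e0.2)%:R - (traverses c e0.2 e0.1)%:R.
  rewrite /cycle_sign; case: ifP => [/no_back ->|_]; first by rewrite subr0.
  by case: ifP; rewrite sub0r ?oppr0.
apply/eqP; rewrite -addr_eq0; set f := h e.1 - h e.2.
have -> : f = (traverses c e.1 e.2)%:R * f by rewrite trav mul1r.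
rewrite -[X in _ == X](cycle_telescope h Uc) -!sum_traverses // mulr_suml.
rewrite -sumrB -big_split /=; apply/eqP; apply: eq_big_seq => u uc.
(* A step of the cycle runs along an edge e', which is e or in T, either upwards
   or downwards; both sides agree in each case, and e is never run downwards. *)
have [e' + [[uE vE]|[uE vE]]] := adjacentP (next_cycle cycc uc).
  rewrite vE uE !hasse_edge_eqE hasse_edge_antiparallel subr0.
  case/setU1P => [->|e'T]; first by rewrite eqxx ne0 mul1r addr0.
  have /negPf -> : e' != e by apply: contraNneq eT => <-.
  by rewrite mul0r add0r hT.
rewrite vE uE [(e'.2 == e.1) && _]andbC [(e'.2 == e0.1) && _]andbC.
rewrite [(e'.2 == e0.2) && _]andbC !hasse_edge_eqE !hasse_edge_antiparallel.
case/setU1P => [e'e|e'T]; last by rewrite mul0r add0r sub0r -hT // opprB.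
have : traverses c e.2 e.1 by rewrite /traverses -e'e -uE uc vE eqxx.
by rewrite no_back.
Qed.

(** If each vertex is the lower end of at most one edge of T, the upward walk
    from a vertex is determined.  The function h indicates whether this walk
    meets the lower end of e0; following one edge e does not change the answer
    unless e = e0, and above e0 the walk can no longer come back. *)
Lemma tree_cut T e0 :
    {in T &, forall e e', e.1 = e'.1 -> e = e'} -> e0 \in T ->
  exists2 h : hat P -> int, h HTop = 0 &
    forall e, e \in T -> h e.1 - h e.2 = (e == e0)%:R.
Proof.
move=> lowT e0T; pose U u v := [exists e in T, val e == (u, v)].
have U_le u v : connect U u v -> (u <= v)%O.
  case/connectP => p; elim: p u => [|w p IHp] u /=; first by move=> _ ->.
  case/andP => /exists_inP[e _ /eqP eE] pU lastp.
  apply: le_trans (IHp w pU lastp); have := edge_lt e.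
  by rewrite [edge_pair e]eE /= => /ltW.
exists (fun v => (connect U v e0.1)%:R) => [|e eT].
  by case: (boolP (connect _ _ _)) => // /U_le; rewrite edge_neq_top.
have [<-|ne] := eqVneq e e0.
  case: (boolP (connect U e.2 _)) => [/U_le|_].
    by rewrite (lt_geF (edge_lt e)).
  by rewrite connect0 subr0.
suff -> : connect U e.1 e0.1 = connect U e.2 e0.1 by rewrite subrr.
apply/idP/idP; last first.
  apply: connect_trans; apply: connect1; apply/exists_inP; exists e => //.
  by rewrite -surjective_pairing.
case/connectP => -[|w p] /=.
  by move=> _ /esym/lowT e0e; rewrite e0e ?eqxx in ne.
case/andP => /exists_inP[e' e'T /eqP e'E] pU lastp.
have e'e : e' = e by apply: lowT => //; rewrite [edge_pair e']e'E.
apply/connectP; exists p; first by rewrite -e'e [edge_pair e']e'E.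
by rewrite -e'e [edge_pair e']e'E.
Qed.

End Cycles.

(** * The class of the prime of a tree edge *)

Theorem mainTheorem3 (K : fieldType)
    (d : Order.disp_t) (P : finPOrderType d) (n : nat) (n_gt0 : (0 < n)%N)
    (x : labeling P n)
    (r : nat) (le_nr : (n <= r)%N)
    (e : 'I_r.+1 -> hasse_edge P) (e_bij : bijective e)
    (e_lower : forall i : 'I_r.+1, (i <= n)%N -> (e i).1 = vertex x (inord i))
    (T : {set hasse_edge P}) (T_def : T = [set e i | i : 'I_r.+1 & (i <= n)%N])
    (T_tree : spanning_tree T)
    (i : 'I_r.+1) (le_in : (i <= n)%N) :
  divisor_class (edge_prime K x (e i)) =
    \sum_(j < r.+1 | (n < j)%N)
      divisor_class (edge_prime K x (e j)) *~
        cycle_sign (fundamental_cycle T (e j)) (e i).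
Proof.
have e_inj := bij_inj e_bij.
have inT j : (e j \in T) = (j <= n)%N by rewrite T_def mem_imset // inE.
have lowT : {in T &, forall e1 e2 : hasse_edge P, e1.1 = e2.1 -> e1 = e2}.
  move=> e1 e2; rewrite T_def => /imsetP[j + ->] /imsetP[k + ->].
  rewrite !inE => jn kn; rewrite !e_lower // => /vertex_inj.
  move/(congr1 val); rewrite /= !inordK ?ltnS // => jk.
  by congr e; apply: val_inj.
have iT : e i \in T by rewrite inT.
have [h hT cut] := tree_cut lowT iT.
have form e' : edge_form x e' (\row_k h (vertex x k)) = h e'.1 - h e'.2.
  by rewrite /edge_form !coord_fun.
have := @divisor_class_relation K _ _ _ x (\row_k h (vertex x k)).
(* Isolate in the relation of h the term of e_i; the other tree edges vanish. *)
rewrite (reindex e) /=; last exact: onW_bij.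
rewrite (bigID (fun j : 'I_r.+1 => (n < j)%N)) /= addrC (bigD1 i) -?leqNgt //=.
rewrite form cut // eqxx mulr1z big1 ?addr0 => [|j]; last first.
  rewrite -leqNgt => /andP[jn /negPf ji].
  by rewrite form cut ?inT // (inj_eq e_inj) ji mulr0z.
move/(canRL (addrK _)) => ->; rewrite sub0r -sumrN; apply: eq_bigr => j nj.
have jT : e j \notin T by rewrite inT -ltnNge.
have [cyc trav] := fundamental_cycleP (proj1 T_tree) jT.
by rewrite form (cycle_sign_cut cut iT jT cyc trav) mulrNz opprK.
Qed.
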